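(* Let $n\geqslant3$. Consider the set $[n]^{(2)}$ of all ordered pairs $(i,j)$, $i,j\in[n]$, $i\neq j$, and let $\mathbb{B}([n]^{(2)})$ be the boolean lattice of all subsets of this set. Let $\operatorname{Cy}\subset\mathbb{B}([n]^{(2)})$ be the subset of all (oriented) cycles on $n$ vertices. Then the (semi)lattice $\operatorname{Jc}_n$ formed by the unions of elements of $\operatorname{Cy}$ in $\mathbb{B}([n]^{(2)})$ is isomorphic to the lattice of faces of a convex $n(n-2)$-dimensional polytope. In particular, the geometrical realization $|\operatorname{Jc}_n\setminus\{\hat0,\hat1\}|$ is homeomorphic to the $(n^2-2n-1)$-dimensional sphere.
   Context: $[n]=\{1,\ldots,n\}$. Subsets of $[n]^{(2)}$ are identified with directed graphs on the vertex set $[n]$. An oriented cycle is the edge set $\{(i_1,i_2),(i_2,i_3),\ldots,(i_{s-1},i_s),(i_s,i_1)\}$ with $s\geqslant2$ and $i_1,\ldots,i_s\in[n]$ pairwise distinct. $\operatorname{Jc}_n$ consists of all unions of (possibly empty) subfamilies of $\operatorname{Cy}$, ordered by inclusion; $\hat0=\varnothing$ is the empty union and $\hat1=[n]^{(2)}$. The lattice of faces of a polytope includes the empty face and the polytope itself and is ordered by inclusion. The geometrical realization $|S|$ of a finite poset $S$ is that of its order complex (simplices are the chains of $S$). *)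

(* Defs.v *)
From mathcomp Require Import all_boot all_order all_algebra.
From mathcomp Require Import all_classical all_reals all_analysis.

Set Implicit Arguments.
Unset Strict Implicit.
Unset Printing Implicit Defensive.

Import Order.TTheory GRing.Theory Num.Theory.
Import numFieldNormedType.Exports Order.DefaultSetSubsetOrder.

Local Open Scope ring_scope.
Local Open Scope classical_set_scope.

Definition opair (n : nat) : finType := {p : 'I_n * 'I_n | p.1 != p.2}.

(* The sequence s = [:: i_1; ...; i_k] is read cyclically: [next s] sends i_j
   to i_(j+1) and i_k back to i_1. *)
Definition cycle_edges (n : nat) (s : seq 'I_n) : {set opair n} :=
  [set a : opair n |
    ((val a).1 \in s) && (next s (val a).1 == (val a).2)]%SET.

Definition Cy (n : nat) : {set {set opair n}} :=
  [set C : {set opair n} |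
    `[< exists s : seq 'I_n,
          [/\ uniq s, (2 <= size s)%N & C = cycle_edges s] >]]%SET.

Definition Jc (n : nat) : {set {set opair n}} :=
  [set finset.cover F | F in powerset (Cy n)]%SET.

(* Isomorphism of the subposets A of T and B of U.  When these are lattices,
   this is the same as an isomorphism of lattices. *)
Definition order_isomorphic (d d' : Order.disp_t)
    (T : porderType d) (U : porderType d') (A : set T) (B : set U) : Prop :=
  exists2 f : T -> U, set_bij A B f & {in A &, {mono f : x y / (x <= y)%O}}.

Section Polytopes.
Context {R : realType} {E : vectType R}.
Implicit Types (P F V : set E).

Definition convex_hull V : set E := smallest (@convex_set R E) V.

Definition polytope P : Prop :=
  exists2 V : set E, finite_set V & P = convex_hull V.

Definition affine_set V : Prop :=
  forall (x y : E) (t : R), V x -> V y -> V (t *: x + (1 - t) *: y).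

Definition affine_hull V : set E := smallest affine_set V.

(* P is nonempty and its affine hull is a translate of a k-dimensional linear
   subspace. *)
Definition has_dim P (k : nat) : Prop :=
  exists (x0 : E) (U : {vspace E}),
    \dim U = k /\ affine_hull P = [set x0 + u | u in [set` U]].

(* A face is the locus where a linear inequality valid on P is tight.  The
   inequalities 0 <= 0 and 0 <= 1 give P itself and the empty face. *)
Definition face P F : Prop :=
  exists (f : {scalar E}) (b : R),
    (forall x, P x -> f x <= b) /\ F = [set x | P x /\ f x = b].

Definition faces P : set (set E) := [set F | face P F].

End Polytopes.

(* |A| for the subposet A of a finite poset S, in barycentric coordinates: the
   coordinate of w at x is w 0 (enum_rank x), and the support of w must be a
   chain of A.  As the order complex is finite, its topology is the one induced
   by R^S. *)
Definition geometric_realization (R : realType) (d : Order.disp_t)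
    (S : finPOrderType d) (A : {set S}) : set 'rV[R]_#|S| :=
  [set w : 'rV[R]_#|S| |
     [/\ forall x : S, 0 <= w 0 (enum_rank x),
         \sum_(x : S) w 0 (enum_rank x) = 1,
         forall x : S, w 0 (enum_rank x) != 0 -> x \in A
       & forall x y : S, w 0 (enum_rank x) != 0 ->
           w 0 (enum_rank y) != 0 -> (x >=< y)%O]].
Arguments geometric_realization R {d S} A.

Definition unit_sphere (R : realType) (m : nat) : set 'rV[R]_m.+1 :=
  [set x : 'rV[R]_m.+1 | \sum_(i < m.+1) x 0 i ^+ 2 = 1].
Arguments unit_sphere R m : clear implicits.

Definition homeomorphic (T U : topologicalType) (A : set T) (B : set U) :
    Prop :=
  exists (f : T -> U) (g : U -> T),
    [/\ {homo f : x / A x >-> B x}, {homo g : y / B y >-> A y},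
        {in A, cancel f g} & {in B, cancel g f}] /\
    {within A, continuous f} /\ {within B, continuous g}.

(* Main.v *)
(* Regard a set of arcs as a set of coordinates on circulations, that is, arc
   weightings with equal inflow and outflow at every vertex. Following an arc of
   positive weight forward eventually leads back to its tail, so the unions of
   cycles are exactly the supports of nonnegative circulations, and hence the
   face lattice of the polytope P of nonnegative circulations of total weight 1;
   flow conservation and the normalization are n independent equations, so
   dim P = n (n - 1) - n.

   Choose a point b_S of P with support S for every nonempty union of cycles S.
   Subtracting from x the largest multiple of b_(supp x) that leaves it
   nonnegative, and repeating, writes every x in P in a unique way as a convex
   combination of points b_S along a chain. This shows that P is the convex hull
   of the b_S and identifies the order complex of the proper part with the
   boundary of P, which is projected radially from the interior point b_full
   onto a sphere; compactness makes the inverse continuous. *)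
From HB Require Import structures.
Require Import Defs.
From mathcomp Require Import all_boot all_order all_algebra.
From mathcomp Require Import all_classical all_reals all_analysis.
From mathcomp Require Import zify lra.
Import Order.TTheory GRing.Theory Num.Theory.
Import numFieldNormedType.Exports Order.DefaultSetSubsetOrder.

Set Implicit Arguments.
Unset Strict Implicit.
Unset Printing Implicit Defensive.

Local Open Scope ring_scope.
Local Open Scope classical_set_scope.

(** * Topological preliminaries *)

(** A closed subset of the compact set [A] is compact, so its image is compact and hence closed in
    the Hausdorff space [U]; this is continuity of the inverse. *)
Lemma compact_bij_homeomorphic (X U : topologicalType) (dflt : U -> X)
    (A : set X) (B : set U) (f : X -> U) :
  compact A -> hausdorff_space U -> {within A, continuous f} -> set_bij A B f ->
  homeomorphic A B.
Proof.
move=> cA hU cf bf; have [fAB finj fsurj] := bf.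
pose g := 'pinv_dflt A f; have [gBA _ _] := bijpinv_bij dflt bf.
have fK : {in A, cancel f g} by apply: pinvKV.
have gK : {in B, cancel g f} by apply: surjpK.
exists f, g; split; first by split.
split=> //; apply/continuous_closedP => C clC; apply/closed_subspaceP.
exists (f @` (A `&` C)).
  apply: compact_closed => //; apply: continuous_compact.
    by apply: continuous_subspaceW cf => x [].
  exact: compact_closedI.
apply/seteqP; split=> y [].
  move=> [x [Ax Cx] <-] Bfx; split=> //.
  by have : C (g (f x)) by rewrite fK //; apply: mem_set.
move=> /= Cgy By; split=> //; exists (g y); last by rewrite gK //; apply: mem_set.
by split=> //; apply: gBA.
Qed.

Lemma mx_continuous_at (R : realType) (X : topologicalType) m n
    (f : X -> 'M[R]_(m, n)) (x : X) :
  (forall i j, {for x, continuous (fun y => f y i j)}) -> {for x, continuous f}.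
Proof.
move=> cf D [E fE sED].
apply: (@filterS _ (nbhs x) _ [set y | forall i j, E i j (f y i j)]).
  by move=> y Ey; apply: sED.
apply: filter_forall => i; apply: filter_forall => j.
exact: cf (fE i j).
Qed.

(** * Supports, total mass and rays in the nonnegative orthant *)

Section Entries.
Context {R : realType} {T : finType}.
Implicit Types (x y u : 'rV[R]_#|T|) (a : T) (S : {set T}).

Definition entry x a : R := x 0 (enum_rank a).
Definition supp x : {set T} := [set a | entry x a != 0]%SET.
Definition mass x : R := \sum_a entry x a.

Lemma entry_inj x y : entry x =1 entry y -> x = y.
Proof.
by move=> xy; apply/rowP => i; have := xy (enum_val i); rewrite /entry enum_valK.
Qed.

Lemma entry0 a : entry 0 a = 0. Proof. by rewrite /entry mxE. Qed.
Lemma entryD x y a : entry (x + y) a = entry x a + entry y a.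
Proof. by rewrite /entry mxE. Qed.
Lemma entryZ t x a : entry (t *: x) a = t * entry x a.
Proof. by rewrite /entry mxE. Qed.
Lemma entryB x y a : entry (x - y) a = entry x a - entry y a.
Proof. by rewrite /entry !mxE. Qed.
Definition entryE := (entry0, entryB, entryD, entryZ).

Lemma entry_sum (I : finType) (F : I -> 'rV[R]_#|T|) a :
  entry (\sum_i F i) a = \sum_i entry (F i) a.
Proof. by rewrite /entry summxE. Qed.

Lemma massD x y : mass (x + y) = mass x + mass y.
Proof. by rewrite /mass -big_split; apply: eq_bigr => a _; rewrite entryD. Qed.
Lemma massZ t x : mass (t *: x) = t * mass x.
Proof. by rewrite /mass mulr_sumr; apply: eq_bigr => a _; rewrite entryZ. Qed.
Lemma massB x y : mass (x - y) = mass x - mass y.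
Proof. by rewrite -scaleN1r massD massZ mulN1r. Qed.
Lemma mass0 : mass 0 = 0.
Proof. by rewrite -(scale0r 0) massZ mul0r. Qed.
Lemma mass_sum (I : finType) (F : I -> 'rV[R]_#|T|) :
  mass (\sum_i F i) = \sum_i mass (F i).
Proof.
by rewrite /mass exchange_big; apply: eq_bigr => a _; rewrite entry_sum.
Qed.

Lemma in_supp x a : (a \in supp x) = (entry x a != 0).
Proof. by rewrite inE. Qed.

Lemma supp0 : supp 0 = finset.set0.
Proof. by apply/setP => a; rewrite in_supp entry0 eqxx inE. Qed.

Lemma supp_eq0 x : supp x = finset.set0 -> x = 0.
Proof.
move=> x0; apply: entry_inj => a; rewrite entry0; apply/eqP.
by rewrite -[_ == _]negbK -in_supp x0 inE.
Qed.

Lemma mass_eq0 x : (forall a, 0 <= entry x a) -> mass x = 0 -> x = 0.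
Proof.
move=> x0 mx; apply: entry_inj => a; rewrite entry0.
by apply: (psumr_eq0P _ mx) => // i _.
Qed.

(** The ratio test: [t] is the least [entry x a / - entry u a] over the decreasing coordinates, and
    the minimizing coordinate is the one that reaches zero. *)
Lemma ray_exit x u : (forall a, 0 <= entry x a) ->
    (forall a, entry u a < 0 -> 0 < entry x a) -> (exists a, entry u a < 0) ->
  exists t : R, [/\ 0 < t, forall a, 0 <= entry x a + t * entry u a &
    exists2 a, entry u a < 0 & entry x a + t * entry u a = 0].
Proof.
move=> x0 xu [a0 ua0].
case: (@arg_minP _ _ _ a0 [pred a | entry u a < 0]
  (fun a => entry x a / - entry u a) ua0) => b /= ub bmin.
have tb : entry x b / - entry u b * entry u b = - entry x b.
  by rewrite invrN mulrN mulNr divfK // lt_eqF.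
exists (entry x b / - entry u b); split.
- by rewrite divr_gt0 ?oppr_gt0 ?xu.
- move=> a; have [ua|ua] := ltP (entry u a) 0; last first.
    by rewrite addr_ge0 // mulr_ge0 // divr_ge0 ?oppr_ge0 // ltW.
  have := bmin a ua; rewrite /= ler_pdivlMr ?oppr_gt0 // mulrN.
  by lra.
- by exists b => //; rewrite tb subrr.
Qed.

Lemma ray_start x u : (forall a, 0 <= entry x a) ->
    (forall a, entry u a < 0 -> 0 < entry x a) ->
  exists2 t : R, 0 < t & forall a, 0 <= entry x a + t * entry u a.
Proof.
move=> x0 xu; have [/existsP[a ua]|/existsPn up] := boolP [exists a, entry u a < 0].
  by have [|t [? ? _]] := @ray_exit x u x0 xu; [exists a|exists t].
(* With no decreasing coordinate any positive step would do. *)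
exists 1 => // a; have := up a; rewrite -leNgt mul1r => ua.
exact: addr_ge0.
Qed.

Lemma in_supp_gt0 x a : (forall a, 0 <= entry x a) ->
  (a \in supp x) = (0 < entry x a).
Proof. by move=> x0; rewrite in_supp lt_neqAle eq_sym x0 andbT. Qed.

Lemma suppD x y :
    (forall a, 0 <= entry x a) -> (forall a, 0 <= entry y a) ->
  supp (x + y) = (supp x :|: supp y)%SET.
Proof.
move=> x0 y0; apply/setP => a.
by rewrite !inE entryD paddr_eq0 // negb_and.
Qed.

Lemma suppZ t x : t != 0 -> supp (t *: x) = supp x.
Proof. by move=> t0; apply/setP => a; rewrite !inE entryZ mulf_eq0 negb_or t0. Qed.

End Entries.

Lemma continuous_entry (R : realType) (T : finType) (a : T) :
  continuous (fun x : 'rV[R]_#|T| => entry x a).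
Proof. exact: coord_continuous. Qed.

(** The realization is a closed subset of the unit cube. *)
Lemma compact_geometric_realization (R : realType) (disp : Order.disp_t)
    (S : finPOrderType disp) (A : {set S}) : compact (geometric_realization R A).
Proof.
pose cube := [set w : 'rV[R]_#|S| | forall i, `[0, 1]%classic (w ord0 i)].
have cube_compact : compact cube.
  apply: (@rV_compact _ _ (fun=> `[(0 : R), 1]%classic)).
  by move=> _; apply: segment_compact.
have cl (f : 'rV[R]_#|S| -> R) (D : set R) :
    continuous f -> closed D -> closed (f @^-1` D).
  by move=> cf; apply: preimage_closed => x _; apply: cf.
(* The chain condition is turned into closed equations: the product of two incomparable coordinates
   vanishes. *)
have -> : geometric_realization R A =
    \bigcap_x [set w | 0 <= entry w x] `&` (mass @^-1` [set 1]) `&`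
    \bigcap_(x in [set x | x \notin A]) ((fun w => entry w x) @^-1` [set 0]) `&`
    \bigcap_(xy in [set xy : S * S | ~~ (xy.1 >=< xy.2)%O])
      ((fun w => entry w xy.1 * entry w xy.2) @^-1` [set 0]).
  apply/seteqP; split=> w.
    move=> [w0 w1 wA wc]; split; [split; [split=> // x _; apply: w0|]|].
      by move=> x /= xA; apply/eqP; apply: contraNT xA; apply: wA.
    move=> [x y] /= /negP xy; apply/eqP; rewrite mulf_eq0; apply/norP => -[xw yw].
    by apply: xy; apply: wc.
  move=> [[[w0 w1] wA] wc]; split=> //.
  - by move=> x; apply: w0 I.
  - by move=> x; apply: contraNT => xA; apply/eqP; apply: wA.
  - move=> x y xw yw; apply: contraT => /(wc (x, y)) /eqP.
    by rewrite mulf_eq0 (negPf xw) (negPf yw).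
apply: subclosed_compact cube_compact _.
  apply: closedI; first apply: closedI; first apply: closedI.
  - apply: closed_bigI => x _.
    apply: (cl (fun w => entry w x) [set y | 0 <= y]).
      exact: continuous_entry.
    exact: closed_ge.
  - apply: (cl mass [set 1]); last exact: closed_eq.
    apply: continuous_big => [|a _]; [exact: add_continuous|exact: continuous_entry].
  - apply: closed_bigI => x _; apply: (cl (fun w => entry w x) [set 0]).
      exact: continuous_entry.
    exact: closed_eq.
  - apply: closed_bigI => xy _.
    apply: (cl (fun w => entry w xy.1 * entry w xy.2) [set 0]); last exact: closed_eq.
    move=> w.
    by apply: continuousM; apply: continuous_entry.
move=> w [[[w0 w1] _] _] i; rewrite /= in_itv /=.
have wi : w ord0 i = entry w (enum_val i) by rewrite /entry enum_valK.
have w_ge0 x : 0 <= entry w x by apply: w0.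
rewrite wi w_ge0 /= -w1 /mass (bigD1 (enum_val i)) //= lerDl.
by apply: sumr_ge0 => x _; apply: w_ge0.
Qed.

(** * The cone of nonnegative solutions of [x *m M = 0] and its slice of mass 1 *)

Section Slice.
Context {R : realType} {T : finType} {k : nat} (M : 'M[R]_(#|T|, k)).
Implicit Types (x y u : 'rV[R]_#|T|) (S : {set T}) (w : {set T} -> R).

Definition cone : set 'rV[R]_#|T| :=
  [set x | x *m M = 0 /\ forall a, 0 <= entry x a].

Definition slice : set 'rV[R]_#|T| := [set x | cone x /\ mass x = 1].

Lemma cone0 : cone 0.
Proof. by split=> [|a]; rewrite ?mul0mx ?entryE. Qed.

Lemma coneD x y : cone x -> cone y -> cone (x + y).
Proof.
move=> [x0 xp] [y0 yp]; split=> [|a]; first by rewrite mulmxDl x0 y0 addr0.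
by rewrite entryD addr_ge0.
Qed.

Lemma coneZ t x : 0 <= t -> cone x -> cone (t *: x).
Proof.
move=> t0 [x0 xp]; split=> [|a]; first by rewrite -scalemxAl x0 scaler0.
by rewrite entryZ mulr_ge0.
Qed.

Lemma cone_sum (I : finType) (F : I -> 'rV[R]_#|T|) :
  (forall i, cone (F i)) -> cone (\sum_i F i).
Proof.
move=> cF; apply: (big_ind (fun x => cone x)) => [||i _]; last exact: cF.
- exact: cone0.
- exact: coneD.
Qed.

Lemma slice_supp_neq0 x : slice x -> supp x != finset.set0.
Proof.
move=> [_ m1]; apply/eqP => /supp_eq0 x0.
by move: m1; rewrite x0 mass0 => /eqP; rewrite eq_sym oner_eq0.
Qed.

Lemma slice_normalize x : cone x -> x != 0 ->
  0 < mass x /\ slice ((mass x)^-1 *: x).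
Proof.
move=> cx x0; have [_ xp] := cx.
have m0 : 0 < mass x.
  rewrite lt_neqAle sumr_ge0 // andbT eq_sym.
  by apply: contraNN x0 => /eqP /(mass_eq0 xp) ->.
split=> //; split; last by rewrite massZ mulVf // gt_eqF.
by apply: coneZ; rewrite // invr_ge0 ltW.
Qed.

Lemma cone_ray_start x u : cone x -> u *m M = 0 ->
    (forall a, entry u a < 0 -> a \in supp x) ->
  exists2 t : R, 0 < t & cone (x + t *: u).
Proof.
move=> [x0 xp] u0 xu; have [] := @ray_start R T x u => // [a /xu|t t0 tP].
  by rewrite in_supp_gt0.
exists t => //; split=> [|a]; last by rewrite entryD entryZ.
by rewrite mulmxDl -scalemxAl x0 u0 scaler0 addr0.
Qed.

(** [L] abstracts the unions of cycles and [b] the choice of points b_S. Together the two hypotheses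
    say that [L] is exactly the set of supports of cone points, the empty set being at most the
    support of 0. *)
Context (L : {set {set T}}) (b : {set T} -> 'rV[R]_#|T|).
Context (L_supp : forall x, cone x -> supp x \in L).
Context (slice_b : forall S, S \in L -> S != finset.set0 ->
  slice (b S) /\ supp (b S) = S).

(** This is [ray_exit] in the direction [- b (supp x)]: the coordinate that reaches zero leaves the
    support, and none enters because [b (supp x)] has the same support as [x]. *)
Lemma peel x : cone x -> x != 0 ->
  exists2 t : R, 0 < t & cone (x - t *: b (supp x)) /\
    (supp (x - t *: b (supp x)) \proper supp x)%SET.
Proof.
move=> cx x0; have [xM xp] := cx.
have S0 : supp x != finset.set0.
  by apply: contraNN x0 => /eqP /supp_eq0 ->.
have [[[bM bp] _] Sb] := slice_b (L_supp cx) S0.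
set S := supp x in S0 bM bp Sb *.
have [||t [t0 tp [a ba ta]]] := @ray_exit R T x (- b S) xp.
- move=> a; rewrite -[- b S]scaleN1r entryZ mulN1r oppr_lt0.
  by rewrite -!in_supp_gt0 // Sb.
- have /set0Pn[a aS] := S0; exists a.
  by rewrite -[- b S]scaleN1r entryZ mulN1r oppr_lt0 -in_supp_gt0 // Sb.
have cE c : entry (x - t *: b S) c = entry x c + t * entry (- b S) c.
  by rewrite entryB entryZ -[- b S]scaleN1r entryZ mulN1r mulrN.
exists t => //; split.
  split=> [|c]; last by rewrite cE.
  by rewrite mulmxBl -scalemxAl xM bM scaler0 subr0.
apply/properP; split.
  apply/fintype.subsetP => c; rewrite /S !in_supp cE; apply: contra_neq => xc.
  have : c \notin supp (b S) by rewrite Sb /S in_supp xc eqxx.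
  rewrite in_supp negbK => /eqP bc.
  by rewrite xc -[- b S]scaleN1r entryZ bc !mulr0 addr0.
exists a; last by rewrite in_supp cE ta eqxx.
move: ba; rewrite -[- b S]scaleN1r entryZ mulN1r oppr_lt0.
by rewrite -in_supp_gt0 // Sb.
Qed.

(** Induction on the size of the support: peeling writes [x] as [t] times a point of [b] plus
    [1 - t] times the normalized remainder, whose support is smaller. *)
Lemma slice_sub_convex (D : set 'rV[R]_#|T|) :
    (forall x y (t : R), D x -> D y -> 0 <= t -> t <= 1 ->
       D (t *: x + (1 - t) *: y)) ->
    (forall S, S \in L -> S != finset.set0 -> D (b S)) ->
  slice `<=` D.
Proof.
move=> Dconv Db x; have [p] := ubnP #|supp x|; elim: p x => // p IH x ltp sx.
have [cx mx] := sx; have S0 := slice_supp_neq0 sx.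
have x0 : x != 0 by apply: contraNneq S0 => ->; rewrite supp0.
have [t t0 [cy sy]] := peel cx x0.
have [sb _] := slice_b (L_supp cx) S0; have Db_x := Db _ (L_supp cx) S0.
set y := x - _ in cy sy *; have my : mass y = 1 - t.
  by rewrite massB massZ sb.2 mx mulr1.
have xE : x = t *: b (supp x) + y by rewrite addrC subrK.
(* A zero remainder cannot be normalized; then [t] is 1 and [x] is itself [b (supp x)]. *)
have [y0|y0] := eqVneq y 0.
  move: my; rewrite y0 mass0 => /eqP; rewrite eq_sym subr_eq0 => /eqP t1.
  by rewrite xE y0 addr0 -t1 scale1r.
have [my0 sly] := slice_normalize cy y0.
rewrite xE (_ : y = (1 - t) *: ((mass y)^-1 *: y)); last first.
  by rewrite scalerA -my divff ?scale1r // gt_eqF.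
apply: Dconv => //; [|exact: ltW|by rewrite -subr_ge0 -my ltW].
apply: IH => //; rewrite suppZ ?invr_neq0 ?gt_eqF //.
exact: leq_trans (proper_card sy) _.
Qed.

Lemma convex_slice : @convex_set R 'rV[R]_#|T| slice.
Proof.
move=> x y t /set_mem[cx mx] /set_mem[cy my]; apply/mem_set.
change (slice (t%:num *: x + (1 - t%:num) *: y)).
have [t0 t1] : 0 <= t%:num /\ 0 <= 1 - t%:num by rewrite subr_ge0.
split; first by apply: coneD; apply: coneZ.
by rewrite massD !massZ mx my !mulr1 subrKC.
Qed.

(** The generators are all the points [b S], finitely many; they need not be vertices. *)
Lemma polytope_slice : @polytope R 'rV[R]_#|T| slice.
Proof.
exists (b @` [set S | S \in L /\ S != finset.set0]).
  by apply: finite_image; apply: finite_finset.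
apply/seteqP; split.
  move=> x sx D [Dconv bD]; move: x sx; apply: slice_sub_convex.
    move=> x y t Dx Dy t0 t1.
    by have := Dconv x y (Itv01 t0 t1) (mem_set Dx) (mem_set Dy) => /set_mem.
  by move=> S SL S0; apply: bD; exists S.
apply: smallest_sub; first exact: convex_slice.
by move=> _ [S [SL S0] <-]; have [] := slice_b SL S0.
Qed.

Lemma supp_convex2 (x y : 'rV[R]_#|T|) (s t : R) : cone x -> cone y ->
  0 < s -> 0 < t -> supp (s *: x + t *: y) = (supp x :|: supp y)%SET.
Proof.
move=> cx cy s0 t0; rewrite suppD ?suppZ ?gt_eqF //.
  by have [] := coneZ (ltW s0) cx.
by have [] := coneZ (ltW t0) cy.
Qed.

(** * The face lattice of the slice *)

Definition slice_face S : set 'rV[R]_#|T| :=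
  [set x | slice x /\ (supp x \subset S)%SET].

(** The functional that exposes [slice_face S]: on the slice it is at most 0, with equality exactly
    when the support lies in [S]. *)
Definition neg_mass_outside S x : R := - \sum_(a | a \notin S) entry x a.

Lemma neg_mass_outside_is_linear S : scalar (neg_mass_outside S).
Proof.
move=> t x y; rewrite /neg_mass_outside mulrN -opprD mulr_sumr -big_split.
by congr (- _); apply: eq_bigr => a _; rewrite entryD entryZ.
Qed.
HB.instance Definition _ S := GRing.isLinear.Build R 'rV[R]_#|T| R *%R
  (neg_mass_outside S) (neg_mass_outside_is_linear S).

Lemma face_slice_face S : @face R 'rV[R]_#|T| slice (slice_face S).
Proof.
exists (neg_mass_outside S : {scalar _}), 0; split.
  by move=> x [[_ xp] _]; rewrite oppr_le0 sumr_ge0.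
apply/seteqP; split=> x [sx].
  move=> /fintype.subsetP xS; split=> //.
  apply/eqP; rewrite oppr_eq0 big1 // => a aS.
  by apply/eqP; apply: contraNT aS; rewrite -in_supp => /xS.
move=> /eqP; rewrite oppr_eq0 => /eqP x0; split=> //.
apply/fintype.subsetP => a; rewrite in_supp; apply: contraNT => aS; apply/eqP.
by apply: (psumr_eq0P _ x0) => // i _; have [[]] := sx.
Qed.

(** A face is determined by a point [y] in it of maximal support: it consists of all slice points
    supported in [supp y]. *)
Lemma face_slice F : @face R 'rV[R]_#|T| slice F ->
  exists2 S, S \in L & F = slice_face S.
Proof.
move=> [f [v [fv FE]]].
have Fs x : F x -> slice x by rewrite FE => -[].
have [F0|/set0P[z Fz]] := eqVneq F set0.
  (* The empty face comes from the empty set, since no slice point has empty support. *)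
  exists finset.set0; first by rewrite -(supp0 (R := R)); apply/L_supp/cone0.
  rewrite F0; apply/seteqP; split=> // x [sx].
  by rewrite finset.subset0 (negPf (slice_supp_neq0 sx)).
pose p i := `[< exists2 y, F y & #|supp y| = i >].
have p_ex : exists i, p i by exists #|supp z|; apply/asboolP; exists z.
have p_le i : p i -> (i <= #|T|)%N by move=> /asboolP[y _ <-]; apply: max_card.
case: (ex_maxnP p_ex p_le) => i /asboolP[y Fy <-] ymax.
have sy := Fs y Fy; exists (supp y); first by apply: L_supp; case: sy.
apply/seteqP; split=> x.
  move=> Fx; have sx := Fs x Fx; split=> //.
  have half : (2^-1 + 2^-1 = 1 :> R)%R by lra.
  (* The midpoint of [x] and [y] stays in the face and its support is the union of theirs, so
     maximality forces [supp x] into [supp y]. *)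
  have Fxy : F (2^-1 *: x + 2^-1 *: y).
    move: Fx Fy; rewrite FE /= => -[_ fx] [_ fy]; split.
      split; first by apply: coneD; apply: coneZ; [lra|case: sx|lra|case: sy].
      by rewrite massD !massZ sx.2 sy.2 -mulrDl half mul1r.
    by rewrite linearP [f (_ *: _)]linearZ /= fx fy -mulrDl half mul1r.
  have := ymax _ (introT (asboolP _) (ex_intro2 _ _ _ Fxy erefl)).
  rewrite supp_convex2 ?invr_gt0 //; [|by case: sx|by case: sy].
  move=> le; have : (supp y == supp x :|: supp y)%SET.
    by rewrite eqEcard finset.subsetUr le.
  by move=> /eqP ->; apply: finset.subsetUl.
move=> [sx /fintype.subsetP xy].
(* Since [supp x] lies in [supp y], the segment from [x] to [y] extends a little beyond [y]. There
   [f] is still at most [v], and [f y = v], so [f x] cannot be below [v]. *)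
have [|||t t0 ct] := @cone_ray_start y (y - x).
- by case: sy.
- by have [[xM _] _] := sx; have [[yM _] _] := sy; rewrite mulmxBl xM yM subrr.
- move=> a; apply: contraTT => ay; have := contra (xy a) ay.
  move: ay; rewrite !in_supp !negbK entryB => /eqP -> /eqP ->.
  by rewrite subrr ltxx.
have fle : f (y + t *: (y - x)) <= v.
  by apply: fv; split=> //; rewrite massD massZ massB sx.2 sy.2 subrr mulr0 addr0.
rewrite FE; split=> //; apply: le_anti; rewrite fv //=.
have fy : f y = v by move: Fy; rewrite FE => -[].
move: fle; rewrite addrC linearP linearB fy.
by rewrite gerDr pmulr_rle0 // subr_le0.
Qed.

Lemma slice_face_iso : order_isomorphic [set` L] (@faces R 'rV[R]_#|T| slice).
Proof.
(* Inclusion of faces is tested on the single point [b S1], whose support is all of [S1]. *)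
have mono S1 S2 : S1 \in L -> (slice_face S1 `<=` slice_face S2) <-> (S1 \subset S2).
  move=> S1L; split=> [sub|S12 x [sx /fintype.subset_trans xS]]; last first.
    by split=> //; apply: xS.
  have [->|S0] := eqVneq S1 finset.set0; first exact: finset.sub0set.
  have [sb Sb] := slice_b S1L S0.
  have [_] : slice_face S2 (b S1) by apply: sub; split=> //; rewrite Sb.
  by rewrite Sb.
exists slice_face; first split.
- by move=> S _; apply: face_slice_face.
- move=> S1 S2 /set_mem S1L /set_mem S2L E; apply/eqP; rewrite finset.eqEsubset.
  by apply/andP; split; apply/mono => //; rewrite E.
- by move=> F /face_slice[S SL ->]; exists S.
move=> S1 S2 /set_mem S1L _; rewrite Order.SetSubsetOrder.leEsubset.
by apply/idP/idP; rewrite subsetEset => /mono; apply.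
Qed.

(** * The dimension of the slice, from an interior point and a tangent basis *)

Context (c : 'rV[R]_#|T|).
Context (slice_c : slice c) (supp_c : supp c = [set: T]%SET).

(** The rows of [B] form a basis of the solutions of [u *m M = 0] with mass 0, the space of
    directions of the slice. *)
Context (d : nat) (B : 'M[R]_(d, #|T|)).
Context (free_B : row_free B).
Context (sub_B : forall u, (u <= B)%MS <-> u *m M = 0 /\ mass u = 0).

Lemma entry_c_gt0 a : 0 < entry c a.
Proof. by rewrite -in_supp_gt0 ?supp_c ?inE //; case: slice_c => -[]. Qed.

Lemma slice_sub x : slice x -> (x - c <= B)%MS.
Proof.
move=> [[xM _] mx]; have [[cM _] mc] := slice_c; apply/sub_B.
by rewrite mulmxBl xM cM subrr massB mx mc subrr.
Qed.

Lemma slice_add t u : (u <= B)%MS -> (forall a, 0 <= entry (c + t *: u) a) ->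
  slice (c + t *: u).
Proof.
move=> /sub_B[uM mu] p; have [[cM _] mc] := slice_c; split; first split=> //.
  by rewrite mulmxDl -scalemxAl cM uM scaler0 addr0.
by rewrite massD massZ mu mulr0 addr0.
Qed.

Lemma has_dim_slice : @has_dim R 'rV[R]_#|T| slice d.
Proof.
(* The row space of [B] as a [{vspace _}]; its dimension is [d] because [B] has independent rows. *)
pose g : 'Hom('rV[R]_d, 'rV[R]_#|T|) := linfun (mulmxr B).
exists c, (limg g); split.
  have /eqP g0 : lker g == 0%VS.
    by apply/lker0P => u v; rewrite !lfunE => /(row_free_inj free_B).
  by rewrite limg_dim_eq ?g0 ?capv0 // dimvf; exact: mul1n.
have gP u : u \in limg g <-> (u <= B)%MS.
  split; first by move=> /memv_imgP[v _ ->]; rewrite lfunE /= submxMl.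
  move=> /submxP[v ->]; rewrite -[v *m B]/(mulmxr B v).
  by rewrite -(lfunE (mulmxr B)) memv_img ?memvf.
apply/seteqP; split.
  apply: smallest_sub.
    move=> _ _ t [u /gP uB <-] [v /gP vB <-]; exists (t *: u + (1 - t) *: v).
      by apply/gP; rewrite addmx_sub ?scalemx_sub.
    by rewrite !scalerDr addrACA -scalerDl subrKC scale1r.
  move=> x sx; exists (x - c); last by rewrite subrKC.
  exact/gP/slice_sub.
move=> _ [u /gP uB <-] D [Daff sD].
(* All entries of [c] are positive, so [c + t *: u] is in the slice for some [t > 0]; the affine
   combination with coefficient [t^-1] then reaches [c + u]. *)
have [|a _|t t0 tp] := @ray_start R T c u; first by case: slice_c => -[].
  exact: entry_c_gt0.
have Dt : D (c + t *: u).
  by apply/sD/slice_add => // a; rewrite entryD entryZ.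
have := Daff _ _ t^-1 Dt (sD _ slice_c).
rewrite scalerDr scalerA mulVf ?gt_eqF // scale1r addrAC -scalerDl subrKC.
by rewrite scale1r.
Qed.

(** * Unique decomposition along chains *)

(** Unnormalized barycentric coordinates, with the full set allowed: the remainders left by peeling
    and by cancelling common parts stay in this class. *)
Definition chain_weight w : Prop :=
  [/\ forall S, 0 <= w S,
      forall S, w S != 0 -> S \in L /\ S != finset.set0
    & forall S S', w S != 0 -> w S' != 0 -> (S \subset S') || (S' \subset S)].

Definition combination w := \sum_S w S *: b S.

Lemma cone_term w S : chain_weight w -> cone (w S *: b S).
Proof.
move=> [w0 wL _]; have [->|wS] := eqVneq (w S) 0.
  by rewrite scale0r; apply: cone0.
by apply: coneZ => //; have [SL S0] := wL S wS; have [[]] := slice_b SL S0.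
Qed.

Lemma cone_combination w : chain_weight w -> cone (combination w).
Proof. by move=> cw; apply: cone_sum => S; apply: cone_term. Qed.

Lemma mass_combination w : chain_weight w -> mass (combination w) = \sum_S w S.
Proof.
move=> [_ wL _]; rewrite mass_sum; apply: eq_bigr => S _; rewrite massZ.
have [->|wS] := eqVneq (w S) 0; first by rewrite mul0r.
by have [SL S0] := wL S wS; have [[_ ->]] := slice_b SL S0; rewrite mulr1.
Qed.

(** Nonnegative terms cannot cancel, so the support is the union of the chain, that is, its top. *)
Lemma supp_combination w S0 : chain_weight w -> w S0 != 0 ->
  exists2 S, 0 < w S & supp (combination w) = S.
Proof.
move=> cw wS0; have [w0 wL wc] := cw.
(* In a chain, a member of largest cardinality contains all the others. *)
case: (@arg_maxnP _ S0 [pred S | w S != 0] (fun S => #|S|) wS0) => S /= wS Smax.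
have top S' : w S' != 0 -> S' \subset S.
  move=> wS'; have /orP[//|SS'] := wc S' S wS' wS.
  have : (S == S')%SET by rewrite eqEcard SS'; apply: Smax.
  by move=> /eqP ->.
have sb S' : w S' != 0 -> supp (b S') = S'.
  by move=> /wL[SL Sn]; have [] := slice_b SL Sn.
exists S; first by rewrite lt_neqAle eq_sym wS w0.
have term_ge0 a S' : 0 <= entry (w S' *: b S') a by have [] := cone_term S' cw.
apply/setP => a; rewrite in_supp entry_sum; apply/idP/idP; last first.
  apply: contraL => /eqP sum0; have := psumr_eq0P (fun i _ => term_ge0 a i) sum0.
  move=> /(_ S isT); rewrite entryZ => /eqP; rewrite mulf_eq0 (negPf wS) /=.
  by have := in_supp (b S) a; rewrite (sb S wS) => ->; rewrite negbK.
apply: contraR => aS; apply/eqP; rewrite big1 // => S' _; rewrite entryZ.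
have [->|wS'] := eqVneq (w S') 0; first by rewrite mul0r.
apply/eqP; rewrite mulf_eq0 (negPf wS') /= -[_ == _]negbK -in_supp sb //.
by apply: contra aS => /(fintype.subsetP (top _ wS')).
Qed.

Lemma combinationB w w' :
  combination (fun S => w S - w' S) = combination w - combination w'.
Proof.
rewrite /combination -sumrB; apply: eq_bigr => S _.
by rewrite scalerBl.
Qed.

(* Cancelling the common part leaves combinations with disjointly supported
   weights; the support of a combination is the top of its chain, so if both
   were nonzero they would share their top. *)
Lemma combination_inj w w' : chain_weight w -> chain_weight w' ->
  combination w = combination w' -> w =1 w'.
Proof.
move=> [w0 wL wc] [w0' wL' wc'] E.
pose m S := Num.min (w S) (w' S).
have p_chain v v' : chain_weight v -> (forall S, 0 <= v' S) ->
    chain_weight (fun S => v S - Num.min (v S) (v' S)).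
  move=> [v0 vL vc] v0'.
  have vS S : v S - Num.min (v S) (v' S) != 0 -> v S != 0.
    by apply: contra_neq => ->; rewrite min_l ?subr0.
  split=> [S|S /vS /vL //|S S' /vS ? /vS ?]; last exact: vc.
  by rewrite subr_ge0 ge_min lexx.
have cp : chain_weight (fun S => w S - m S) by apply: p_chain.
have cq : chain_weight (fun S => w' S - m S).
  have -> : m = (fun S => Num.min (w' S) (w S)).
    by apply: funext => S; rewrite /m minC.
  exact: p_chain.
have Epq : combination (fun S => w S - m S) = combination (fun S => w' S - m S).
  by rewrite !combinationB E.
have top_neq0 v S : chain_weight v -> v S != 0 -> combination v != 0.
  move=> cv vS; have [S' vS' vE] := supp_combination cv vS.
  have [] := cv => _ /(_ S'); rewrite gt_eqF // => /(_ isT)[_ S'0] _.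
  by apply: contra_neq S'0 => v0; rewrite -vE v0 supp0.
move=> S; have [//|wS] := eqVneq (w S) (w' S).
have : (w S - m S != 0) || (w' S - m S != 0).
  rewrite -negb_and !subr_eq0; apply: contra wS => /andP[/eqP -> /eqP ->].
  by [].
have : combination (fun S => w S - m S) = 0 \/ combination (fun S => w S - m S) != 0.
  by have [->|] := eqVneq (combination (fun S => w S - m S)) 0; [left|right].
case=> [p0|pn0].
  move=> /orP[pS|qS].
  - by move: (top_neq0 _ S cp pS); rewrite p0 eqxx.
  - by move: (top_neq0 _ S cq qS); rewrite -Epq p0 eqxx.
have nonzero v : combination v != 0 -> exists S, v S != 0.
  move=> cv; apply: contrapT => /forallNP v0; move/negP: cv; apply.
  apply/eqP; apply: big1 => S' _; have /negP := v0 S'.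
  by rewrite negbK => /eqP ->; rewrite scale0r.
have [S1 /(supp_combination cp)[S2 p2 s2]] := nonzero _ pn0.
have [S3 /(supp_combination cq)[S4 q4 s4]] : exists S, w' S - m S != 0.
  by apply: nonzero; rewrite -Epq.
move: q4; rewrite (_ : S4 = S2); last by rewrite -s2 -s4 Epq.
by move: p2; rewrite /m; case: (leP (w S2) (w' S2)) => _; rewrite subrr ltxx.
Qed.

(** Peeling, by induction on the size of the support. The last clause makes the induction work: the
    sets used by the remainder lie below [supp x], so adding [supp x] on top still gives a chain. *)
Lemma combination_surj x : cone x -> exists w, [/\ chain_weight w,
  combination w = x & forall S, w S != 0 -> S \subset supp x].
Proof.
have [p] := ubnP #|supp x|; elim: p x => // p IH x ltp cx.
have [x0|x0] := eqVneq x 0.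
  exists (fun=> 0); split=> [|| S]; rewrite ?eqxx //.
    by split=> // S; rewrite eqxx.
  by rewrite x0; apply: big1 => S _; rewrite scale0r.
have [t t0 [cy sy]] := peel cx x0; set S0 := supp x in t t0 cy sy ltp *.
have S0n : S0 != finset.set0 by apply: contraNneq x0 => /supp_eq0 ->.
have [|//|w [[w0 wL wc] wE wS]] := IH (x - t *: b S0).
  exact: leq_trans (proper_card sy) _.
have wS0 : w S0 = 0.
  apply/eqP; apply: contraTT sy => /wS; rewrite properE => ->.
  by rewrite andbF.
pose v S := t *+ (S == S0) + w S.
have vP S : v S != 0 -> S = S0 \/ w S != 0.
  by rewrite /v; have [->|_] := eqVneq S S0; [left|rewrite add0r; right].
have wsub S : w S != 0 -> S \subset S0.
  by move=> /wS /fintype.subset_trans; apply; apply: proper_sub.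
exists v; split.
- split=> [S|S /vP[->|/wL //]|S S' /vP[->|vS] /vP[->|vS']].
  + by rewrite addr_ge0 // mulrn_wge0 // ltW.
  + by split=> //; apply: L_supp.
  + by rewrite fintype.subxx.
  + by rewrite wsub ?orbT.
  + by rewrite wsub.
  + exact: wc.
- rewrite /combination /v; under eq_bigr do rewrite scalerDl.
  rewrite big_split /= -/(combination w) wE (bigD1 S0) //= eqxx mulr1n.
  rewrite big1 => [|S /negPf ->]; last by rewrite mulr0n scale0r.
  by rewrite addr0 addrC subrK.
- by move=> S /vP[->|/wsub //]; rewrite fintype.subxx.
Qed.

(** * Radial projection of the boundary onto the sphere *)

Definition slice_boundary : set 'rV[R]_#|T| :=
  [set x | slice x /\ supp x != [set: T]%SET].

(** The ambient norm on row vectors is the maximum norm, whereas the target sphere is Euclidean. *)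
Definition euclidean_norm (v : 'rV[R]_d) : R := Num.sqrt (\sum_i v 0 i ^+ 2).

Lemma euclidean_norm_gt0 v : v != 0 -> 0 < euclidean_norm v.
Proof.
move=> v0; rewrite sqrtr_gt0 lt_neqAle sumr_ge0 ?andbT; last first.
  by move=> i _; apply: sqr_ge0.
apply: contraNneq v0 => /esym s0; apply/eqP/rowP => i; rewrite mxE.
have /(_ i isT) /eqP := psumr_eq0P (fun i _ => sqr_ge0 (v 0 i)) s0.
by rewrite sqrf_eq0 => /eqP.
Qed.

Lemma euclidean_normZ t v : 0 <= t -> euclidean_norm (t *: v) = t * euclidean_norm v.
Proof.
move=> t0; rewrite /euclidean_norm.
under eq_bigr do rewrite mxE exprMn.
by rewrite -mulr_sumr sqrtrM ?sqr_ge0 // sqrtr_sqr ger0_norm.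
Qed.

Lemma euclidean_norm_eq1 v : (euclidean_norm v = 1) <-> \sum_i v 0 i ^+ 2 = 1.
Proof.
have s0 : 0 <= \sum_i v 0 i ^+ 2 by apply: sumr_ge0 => i _; apply: sqr_ge0.
split; rewrite /euclidean_norm; last by move=> ->; rewrite sqrtr1.
by move=> /(congr1 (fun z => z ^+ 2)); rewrite sqr_sqrtr // expr1n.
Qed.

(** Coordinates of [x - c] in the basis [B], faithful when [x] is in the slice. *)
Definition direction x : 'rV[R]_d := (x - c) *m pinvmx B.

Definition to_sphere x := (euclidean_norm (direction x))^-1 *: direction x.

Lemma directionK x : slice x -> direction x *m B = x - c.
Proof. by move=> sx; rewrite mulmxKpV // slice_sub. Qed.

Lemma direction_neq0 x : slice_boundary x -> direction x != 0.
Proof.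
move=> [sx bx]; apply: contraNneq bx => d0.
have := directionK sx; rewrite d0 mul0mx => /esym/eqP; rewrite subr_eq0 => /eqP ->.
by rewrite supp_c.
Qed.

Lemma to_sphere_norm x : slice_boundary x -> euclidean_norm (to_sphere x) = 1.
Proof.
move=> /direction_neq0/euclidean_norm_gt0 n0.
by rewrite euclidean_normZ ?invr_ge0 ?ltW // mulVf ?gt_eqF.
Qed.

(** If one of two points on a ray from [c] is strictly nearer to [c], it is a convex combination
    giving [c] positive weight, so all its entries are positive and it is not on the boundary. *)
Lemma boundary_ray_inj x y s t : slice_boundary x -> slice_boundary y ->
  0 < s -> 0 < t -> s *: (x - c) = t *: (y - c) -> x = y.
Proof.
wlog st : x y s t / s <= t.
  move=> H bx xy s0 t0 E; have [st|/ltW st] := leP s t; first exact: (H x y s t).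
  by apply/esym; apply: (H y x t s).
move=> [sx _] [_ by_] s0 t0 E.
have yE : y = c + (s / t) *: (x - c).
  by rewrite mulrC -scalerA E scalerA mulVf ?gt_eqF // scale1r subrKC.
have [st1|st1] := ltP (s / t) 1; last first.
  have -> : y = c + 1 *: (x - c).
    rewrite yE; congr (_ + _ *: _); apply/eqP; rewrite eq_le st1 andbT.
    by rewrite ler_pdivrMr ?mul1r.
  by rewrite scale1r subrKC.
case/negP: by_; apply/eqP/setP => a; rewrite in_supp inE yE gt_eqF //.
have -> : c + (s / t) *: (x - c) = (1 - s / t) *: c + (s / t) *: x.
  by rewrite scalerBl scale1r scalerBr -addrA [- _ + _]addrC.
rewrite entryD !entryZ ltr_pwDl //.
  by rewrite mulr_gt0 ?entry_c_gt0 // subr_gt0.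
by have [[_ xp] _] := sx; rewrite mulr_ge0 // divr_ge0 // ltW.
Qed.

Lemma to_sphere_inj x y : slice_boundary x -> slice_boundary y ->
  to_sphere x = to_sphere y -> x = y.
Proof.
move=> bx by_ E; have [sx _] := bx; have [sy _] := by_.
apply: (@boundary_ray_inj x y (euclidean_norm (direction x))^-1
  (euclidean_norm (direction y))^-1) => //.
- by rewrite invr_gt0; apply: euclidean_norm_gt0 (direction_neq0 bx).
- by rewrite invr_gt0; apply: euclidean_norm_gt0 (direction_neq0 by_).
rewrite -!directionK // (scalemxAl _ (direction x)) (scalemxAl _ (direction y)).
exact: (congr1 (mulmx^~ B) E).
Qed.

(** The preimage is where the ray from [c] in the direction [v *m B] leaves the nonnegative
    orthant. *)
Lemma to_sphere_surj v : euclidean_norm v = 1 ->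
  exists2 x, slice_boundary x & to_sphere x = v.
Proof.
move=> v1; pose u := v *m B; have uB : (u <= B)%MS by apply: submxMl.
have u0 : u != 0.
  apply/eqP => u0; have v0 : v = 0 by apply: (row_free_inj free_B); rewrite mul0mx.
  move: v1; rewrite v0 -(scale0r 0) euclidean_normZ // mul0r => /eqP.
  by rewrite eq_sym oner_eq0.
have [_ mu] := (sub_B u).1 uB.
(* The ray does leave: a vector of mass 0 without negative entries would be zero. *)
have [a ua] : exists a, entry u a < 0.
  apply: contrapT => /forallNP up; case/eqP: u0; apply: mass_eq0 => // a.
  by rewrite leNgt; apply/negP.
have [|a' _||t [t0 tp [a1 _ ta]]] := @ray_exit R T c u.
- by case: slice_c => -[].
- exact: entry_c_gt0.
- by exists a.
have sx : slice (c + t *: u).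
  by apply: slice_add => // a2; rewrite entryD entryZ.
have dx : direction (c + t *: u) = t *: v.
  by rewrite /direction addrC addKr -scalemxAl mulmxKp.
exists (c + t *: u).
  split=> //; apply/eqP => /setP /(_ a1); rewrite in_supp inE entryD entryZ ta.
  by rewrite eqxx.
rewrite /to_sphere dx euclidean_normZ ?ltW // v1 mulr1 scalerA mulVf ?scale1r //.
by rewrite gt_eqF.
Qed.

Let proper_L := (L :\: [set finset.set0; [set: T]])%SET.

Lemma realization_chain_weight (w : 'rV[R]_#|{set T}|) :
  geometric_realization R proper_L w -> chain_weight (entry w).
Proof.
move=> [w0 _ wA wc]; split=> // S /wA.
by rewrite !inE negb_or => /andP[/andP[-> _] ->].
Qed.

(** The support of the combination is the top of its chain, a member of [proper_L], hence not the
    full set. *)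
Lemma realization_boundary (w : 'rV[R]_#|{set T}|) :
  geometric_realization R proper_L w -> slice_boundary (combination (entry w)).
Proof.
move=> gw; have cw := realization_chain_weight gw; have [w0 w1 wA _] := gw.
split; first by split; [apply: cone_combination|rewrite mass_combination].
have [S wS] : exists S, entry w S != 0.
  apply: contrapT => /forallNP w00; move: w1; rewrite big1; last first.
    by move=> S _; have /negP := w00 S; rewrite negbK => /eqP.
  by move=> /eqP; rewrite eq_sym oner_eq0.
have [S' S'0 ->] := supp_combination cw wS.
have := wA S'; rewrite gt_eqF // => /(_ isT).
by rewrite !inE negb_or => /andP[/andP[]].
Qed.

Lemma boundary_realization x : slice_boundary x ->
  exists2 w : 'rV[R]_#|{set T}|, geometric_realization R proper_L w
    & combination (entry w) = x.
Proof.
move=> [[cx mx] bx]; have [v [cv vE vS]] := combination_surj cx.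
pose w : 'rV[R]_#|{set T}| := \row_i v (enum_val i).
have wE : entry w = v by apply: funext => S; rewrite /entry mxE enum_rankK.
have [v0 vL vc] := cv.
exists w; last by rewrite wE.
have wE' S : w 0 (enum_rank S) = v S by rewrite -[LHS]/(entry w S) wE.
split=> [S||S|S S'].
- by rewrite wE'.
- by under eq_bigr do rewrite wE'; rewrite -mass_combination // vE.
- rewrite wE' => wS; have [SL S0] := vL S wS; rewrite !inE SL andbT negb_or S0 /=.
  (* The full set gets no weight, because every set used lies in [supp x]. *)
  by apply: contraNneq bx => ST; have := vS S wS; rewrite ST finset.subTset.
- by rewrite !wE'; apply: vc.
Qed.

(** Each coordinate is an affine function of the weights. *)
Lemma continuous_direction :
  continuous (fun w : 'rV[R]_#|{set T}| => direction (combination (entry w))).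
Proof.
move=> x0; apply: mx_continuous_at => i j.
rewrite (_ : (fun _ => _) = fun w' : 'rV[R]_#|{set T}| =>
    \sum_S entry w' S * (b S *m pinvmx B) i j - (c *m pinvmx B) i j); last first.
  apply: funext => w'.
  rewrite /direction mulmxBl mulmx_suml [LHS]mxE [X in _ + X]mxE summxE; congr (_ - _).
  by apply: eq_bigr => S _; rewrite -scalemxAl mxE.
apply: continuousB; last exact: cst_continuous.
apply: continuous_big => [|S _ w']; first exact: add_continuous.
by apply: continuousM; [apply: continuous_entry|apply: cst_continuous].
Qed.

Lemma continuous_to_sphere (w : 'rV[R]_#|{set T}|) :
  direction (combination (entry w)) != 0 ->
  {for w, continuous
    (fun z : 'rV[R]_#|{set T}| => to_sphere (combination (entry z)))}.
Proof.
move=> dw; apply: mx_continuous_at => i j.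
have cD i' j' : continuous
    (fun w : 'rV[R]_#|{set T}| => direction (combination (entry w)) i' j').
  move=> x'.
  exact: (@continuous_comp _ _ _ _ (fun v : 'rV[R]_d => v i' j') _
    (@continuous_direction x') (@coord_continuous _ _ _ i' j' _)).
rewrite (_ : (fun _ => _) = fun w : 'rV[R]_#|{set T}| =>
    (euclidean_norm (direction (combination (entry w))))^-1 *
    direction (combination (entry w)) i j); last by apply: funext => w'; rewrite mxE.
apply: continuousM; last exact: cD.
apply: continuousV; first by rewrite gt_eqF // euclidean_norm_gt0.
apply: (@continuous_comp _ _ _ (fun z : 'rV[R]_#|{set T}| =>
  \sum_i (direction (combination (entry z))) 0 i ^+ 2) Num.sqrt);
  last exact: sqrt_continuous.
apply: continuous_big => [|k' _ w']; first exact: add_continuous.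
exact: (@continuous_comp _ _ _ _ (fun t : R => t ^+ 2) _ (@cD _ _ _)
  (@exprn_continuous _ 2 _)).
Qed.

Lemma homeomorphic_realization_sphere :
  homeomorphic (geometric_realization R proper_L)
    [set v : 'rV[R]_d | \sum_i v 0 i ^+ 2 = 1].
Proof.
refine (@compact_bij_homeomorphic 'rV[R]_#|{set T}| 'rV[R]_d (fun=> 0) _ _
  (fun z => to_sphere (combination (entry z))) _ _ _ _).
- exact: compact_geometric_realization.
- exact: norm_hausdorff.
- apply: continuous_in_subspaceT => w /set_mem gw; apply: continuous_to_sphere.
  exact: direction_neq0 (realization_boundary gw).
split.
- by move=> w gw; apply/euclidean_norm_eq1/to_sphere_norm/realization_boundary.
- move=> w w' /set_mem gw /set_mem gw' E; apply: (@entry_inj R {set T}).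
  apply: combination_inj; try exact: realization_chain_weight.
  exact: to_sphere_inj (realization_boundary gw) (realization_boundary gw') E.
- move=> v /euclidean_norm_eq1/to_sphere_surj[x bx <-].
  by have [w gw <-] := boundary_realization bx; exists w.
Qed.

End Slice.

(** * Supports of circulations are the unions of cycles *)

Section Circulations.
Context {R : realType} {n : nat}.
Implicit Types (i j v : 'I_n) (a : opair n) (s : seq 'I_n).

(** [x *m incidence] lists the net outflow of [x] at each vertex, so [cone incidence] consists of
    the nonnegative circulations. *)
Definition incidence : 'M[R]_(#|opair n|, n) :=
  \matrix_(k, v) (((val (enum_val k)).1 == v)%:R - ((val (enum_val k)).2 == v)%:R).

Lemma mulmx_incidence (x : 'rV[R]_#|opair n|) v :
  (x *m incidence) 0 v =
  \sum_a entry x a * (((val a).1 == v)%:R - ((val a).2 == v)%:R).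
Proof.
rewrite mxE (reindex enum_rank) /=; last exact/onW_bij/enum_rank_bij.
by apply: eq_bigr => a _; rewrite mxE enum_rankK.
Qed.

Lemma next_neq s v : uniq s -> (2 <= size s)%N -> v \in s -> next s v != v.
Proof.
move=> us ss /rot_to[k t st]; rewrite -(next_rot k us) st.
have ut : uniq (v :: t) by rewrite -st rot_uniq.
case: t st ut => [/(congr1 size)|w t _ /=].
  by rewrite size_rot; case: (size s) ss => [|[]].
by rewrite eqxx inE negb_or eq_sym => /andP[/andP[]].
Qed.

Definition indicator (C : {set opair n}) : 'rV[R]_#|opair n| :=
  \row_k (enum_val k \in C)%:R.

Lemma entry_indicator C a : entry (indicator C) a = (a \in C)%:R.
Proof. by rewrite /entry mxE enum_rankK. Qed.

Lemma sum_unique_arc (P : pred (opair n)) a0 : P a0 ->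
  (forall a, P a -> a = a0) -> \sum_a (P a)%:R = 1 :> R.
Proof.
move=> P0 PU; rewrite (bigD1 a0) //= P0 big1 ?addr0 // => a aa0.
by case: (P a) (PU a) => // /(_ isT) E; rewrite E eqxx in aa0.
Qed.

(** A vertex on the cycle has exactly one outgoing and one incoming arc of the cycle; any other
    vertex has none. *)
Lemma cone_indicator C : C \in Cy n -> cone incidence (indicator C).
Proof.
rewrite inE => /asboolP[s [us ss ->]]; set C' := cycle_edges s.
split; last by move=> a; rewrite entry_indicator ler0n.
apply/rowP => v; rewrite mulmx_incidence mxE.
under eq_bigr do rewrite entry_indicator mulrBr -!natrM !mulnb.
rewrite sumrB; apply/eqP; rewrite subr_eq0; apply/eqP.
have inC a : (a \in C') = ((val a).1 \in s) && (next s (val a).1 == (val a).2).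
  by rewrite inE.
have arc_ex u : u \in s -> exists a, val a = (u, next s u).
  move=> us'; have un : (u, next s u).1 != (u, next s u).2.
    by rewrite /= eq_sym next_neq.
  by exists (Sub (u, next s u) un).
have [vs|vs] := boolP (v \in s).
  have [a1 a1E] := arc_ex v vs.
  have [|a2 a2E] := arc_ex (prev s v); first by rewrite mem_prev.
  rewrite next_prev // in a2E.
  rewrite (@sum_unique_arc _ a1); last first.
  - move=> a /andP[]; rewrite inC => /andP[_ /eqP nE] /eqP va; apply/val_inj.
    by rewrite a1E [LHS]surjective_pairing -nE va.
  - by rewrite inC a1E /= vs !eqxx.
  rewrite (@sum_unique_arc _ a2) //.
  - by rewrite inC a2E /= mem_prev vs next_prev // !eqxx.
  - move=> a /andP[]; rewrite inC => /andP[_ /eqP nE] /eqP va; apply/val_inj.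
    have pa : (val a).1 = prev s v by rewrite -va -nE prev_next.
    by rewrite a2E; case: (val a) va pa => ? ? /= -> ->.
have ends a : a \in C' -> ((val a).1 \in s) && ((val a).2 \in s).
  by rewrite inC => /andP[as_ /eqP <-]; rewrite mem_next as_.
rewrite !big1 // => a _; have [/ends/andP[a1s a2s]|] //= := boolP (a \in C');
  by case: eqP => // va; rewrite -va ?a1s ?a2s in vs.
Qed.

(** Indicators of the cycles in the family are summed; being nonnegative, they do not cancel. *)
Lemma Jc_supp S : S \in Jc n ->
  exists2 x : 'rV[R]_#|opair n|, cone incidence x & supp x = S.
Proof.
move=> /imsetP[F]; rewrite powersetE => /fintype.subsetP FC ->.
exists (\sum_(C in F) indicator C).
  apply: (big_ind (fun x => cone incidence x)) => [||C /FC]; first exact: cone0.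
    exact: coneD.
  exact: cone_indicator.
apply/setP => a; rewrite in_supp /entry summxE.
under eq_bigr do rewrite -[indicator _ _ _]/(entry (indicator _) a) entry_indicator.
rewrite -natr_sum pnatr_eq0 sum_nat_eq0 negb_forall.
apply/existsP/bigcupP.
  by move=> [C]; rewrite negb_imply eqb0 negbK => /andP[CF aC]; exists C.
by move=> [C CF aC]; exists C; rewrite CF aC.
Qed.

Definition supp_rel (x : 'rV[R]_#|opair n|) : rel 'I_n :=
  fun i j => [exists a, (val a == (i, j)) && (a \in supp x)].

Lemma supp_relE x a : supp_rel x (val a).1 (val a).2 = (a \in supp x).
Proof.
apply/existsP/idP => [[a' /andP[/eqP va]]|ax]; last first.
  by exists a; rewrite -surjective_pairing eqxx.
by rewrite (_ : a' = a) //; apply: val_inj; rewrite va -surjective_pairing.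
Qed.

(* Otherwise the set of vertices reachable from the head of a would have
   positive inflow and no outflow. *)
Lemma connect_supp x a : cone incidence x -> a \in supp x ->
  connect (supp_rel x) (val a).2 (val a).1.
Proof.
move=> [xM x0] ax; apply: contraT => nc.
pose X v := connect (supp_rel x) (val a).2 v.
have E : \sum_a' entry x a' * ((X (val a').2)%:R - (X (val a').1)%:R) = 0.
  transitivity (- \sum_(v | X v) (x *m incidence) 0 v); last first.
    by rewrite big1 ?oppr0 // => v _; rewrite xM mxE.
  under [in RHS]eq_bigr do rewrite mulmx_incidence.
  rewrite exchange_big /= -sumrN.
  apply: eq_bigr => a' _; rewrite -mulr_sumr -mulrN; congr (_ * _).
  rewrite sumrB opprB.
  have sumX u : \sum_(v | X v) (u == v)%:R = (X u)%:R :> R.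
    have [Xu|Xu] := boolP (X u).
      rewrite (bigD1 u) //= eqxx big1 ?addr0 // => v /andP[_ /negPf].
      by rewrite eq_sym => ->.
    by apply: big1 => v Xv; case: eqP => // uv; rewrite uv Xv in Xu.
  by rewrite !sumX.
have term_ge0 a' : true -> 0 <= entry x a' * ((X (val a').2)%:R - (X (val a').1)%:R).
  move=> _; have [xa|] := boolP (a' \in supp x); last first.
    by rewrite in_supp negbK => /eqP ->; rewrite mul0r.
  have Xstep : X (val a').1 -> X (val a').2.
    by move=> Xa; apply: connect_trans Xa _; apply: connect1; rewrite supp_relE.
  apply: mulr_ge0 => //; rewrite subr_ge0 ler_nat.
  by case: (X (val a').1) Xstep => // ->.
have /eqP := psumr_eq0P term_ge0 E (i := a) isT.
have -> : X (val a).2 = true by apply: connect0.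
rewrite [X (val a).1](negPf nc) subr0 mulr1.
by move: ax; rewrite in_supp => /negPf ->.
Qed.

(** A path in the support from the head of [a] back to its tail, shortened to a simple one, is
    closed up by [a]. *)
Lemma supp_covered x a : cone incidence x -> a \in supp x ->
  exists C, [/\ C \in Cy n, C \subset supp x & a \in C].
Proof.
move=> cx ax; have /connectP[p0 pp0 pl0] := connect_supp cx ax.
move: pl0; case/shortenP: pp0 => p pp up _ pl.
(* The path is not empty, as [a] is no loop. Its last vertex, the tail of [a], is moved to the front
   so that [s] begins with the arc [a]. *)
have an := valP a; move: pp up pl; case/lastP: p => [|p w].
  by move=> _ _ /= E; move: an; rewrite E eqxx.
rewrite last_rcons => pp up wE; rewrite -{w}wE in pp up.
set s := (val a).1 :: (val a).2 :: p.
have us : uniq s by rewrite -(rot_uniq 1) rot1_cons.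
have cs : cycle (supp_rel x) s.
  by rewrite /= rcons_path supp_relE ax /= -rcons_path.
exists (cycle_edges s); split.
- by rewrite inE; apply/asboolP; exists s.
- apply/fintype.subsetP => a'; rewrite inE => /andP[a's /eqP na'].
  by rewrite -supp_relE -na'; apply: next_cycle.
- by rewrite inE mem_head /= eqxx eqxx.
Qed.

Lemma supp_Jc x : cone incidence x -> supp x \in Jc n.
Proof.
move=> cx; apply/imsetP; exists [set C in Cy n | C \subset supp x]%SET.
  by rewrite powersetE; apply/fintype.subsetP => C; rewrite inE => /andP[].
apply/eqP; rewrite finset.eqEsubset; apply/andP; split; last first.
  by apply/bigcupsP => C; rewrite inE => /andP[].
apply/fintype.subsetP => a /(supp_covered cx)[C [CC Cx aC]].
by apply/bigcupP; exists C => //; apply/setIdP.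
Qed.

Lemma setT_Jc : [set: opair n]%SET \in Jc n.
Proof.
apply/imsetP; exists (Cy n); first by rewrite powersetE.
apply/esym/eqP; rewrite -finset.subTset; apply/fintype.subsetP => a _.
(* Every arc lies on the 2-cycle formed with its reverse. *)
have an := valP a; apply/bigcupP; exists (cycle_edges [:: (val a).1; (val a).2]).
  rewrite inE; apply/asboolP; exists [:: (val a).1; (val a).2]; split=> //.
  by rewrite /= inE an.
by rewrite inE mem_head /= !eqxx.
Qed.

Lemma card_opair : #|opair n| = (n * n.-1)%N.
Proof.
rewrite card_sig -sum1_card.
rewrite -(pair_big_dep xpredT (fun i j => i != j) (fun _ _ => 1%N)) /=.
under eq_bigr => i _.
  under eq_bigl => j do rewrite eq_sym.
  rewrite sum1_card cardC1 card_ord.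
  over.
by rewrite sum_nat_const card_ord.
Qed.

(** * Rank of the tangent equations *)

Definition tangent_eqs : 'M[R]_(#|opair n|, n + 1) := row_mx incidence (const_mx 1).

Lemma mul_tangent_eqs (u : 'rV[R]_#|opair n|) :
  u *m tangent_eqs = 0 <-> u *m incidence = 0 /\ mass u = 0.
Proof.
have mE : u *m const_mx 1 = (mass u)%:M :> 'M[R]_1.
  apply/rowP => i; rewrite ord1 !mxE mulr1n (reindex enum_rank) /=; last first.
    exact/onW_bij/enum_rank_bij.
  by apply: eq_bigr => a _; rewrite mxE mulr1.
rewrite mul_mx_row mE; split=> [/eqP|[-> ->]].
  rewrite row_mx_eq0 => /andP[/eqP -> /eqP m0]; split=> //.
  by move/rowP: m0 => /(_ 0); rewrite !mxE mulr1n.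
by rewrite raddf0 row_mx0.
Qed.

(* A linear relation y_i - y_j + z = 0 for all arcs (i, j), read on an arc and
   on its reverse, forces z = 0 and y constant. *)
Lemma rank_tangent_eqs : (2 <= n)%N -> \rank tangent_eqs = n.
Proof.
move=> n2; have n0 : (0 < n)%N by apply: leq_trans n2.
pose i0 : 'I_n := Ordinal n0; pose i1 : 'I_n := Ordinal n2.
pose e : 'rV[R]_(n + 1) := row_mx (const_mx 1) 0.
have arc_entry (y : 'rV[R]_(n + 1)) a : (y *m tangent_eqs^T) 0 (enum_rank a) =
    lsubmx y 0 (val a).1 - lsubmx y 0 (val a).2 + rsubmx y 0 0.
  rewrite -{1}[y]hsubmxK tr_row_mx mul_row_col mxE; congr (_ + _); last first.
    by rewrite mxE big_ord1 !mxE mulr1.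
  rewrite mxE.
  under eq_bigr do rewrite [_^T _ _]mxE [incidence _ _]mxE enum_rankK mulrBr.
  rewrite sumrB; congr (_ - _).
    rewrite (bigD1 (val a).1) //= eqxx mulr1 big1 ?addr0 // => i /negPf.
    by rewrite eq_sym => ->; rewrite mulr0.
  rewrite (bigD1 (val a).2) //= eqxx mulr1 big1 ?addr0 // => i /negPf.
  by rewrite eq_sym => ->; rewrite mulr0.
have ker : (kermx tangent_eqs^T :=: e)%MS.
  apply/eqmxP/andP; split; last first.
    apply/sub_kermxP/entry_inj => a; rewrite /entry arc_entry.
    by rewrite /e row_mxKl row_mxKr !mxE subrr addr0.
  apply/rV_subP => y /sub_kermxP y0.
  have arc i j : i != j -> lsubmx y 0 i - lsubmx y 0 j + rsubmx y 0 0 = 0.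
    by move=> ij; have := arc_entry y (Sub (i, j) ij); rewrite y0 mxE => ->.
  have z0 : rsubmx y 0 0 = 0.
    by have := arc i0 i1 isT; have := arc i1 i0 isT; lra.
  have -> : y = lsubmx y 0 i0 *: e; last exact: scalemx_sub.
  rewrite -[LHS]hsubmxK scale_row_mx scaler0; congr row_mx.
    apply/rowP => i; rewrite [RHS]mxE [const_mx 1 _ _]mxE mulr1.
    have [->//|ii0] := eqVneq i i0.
    by have /eqP := arc i i0 ii0; rewrite z0 addr0 subr_eq0 => /eqP.
  by apply/rowP => i; rewrite ord1 z0 mxE.
have := mxrank_ker tangent_eqs^T; rewrite ker mxrank_tr rank_rV.
have -> : e != 0.
  apply/eqP => /rowP /(_ (lshift 1 i0)); rewrite row_mxEl !mxE => /eqP.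
  by rewrite oner_eq0.
have := rank_leq_col tangent_eqs; lia.
Qed.

(** The number of rows is a variable [d] so that it can also be a literal successor, the form in
    which the sphere has its coordinates. *)
Lemma tangent_basis d : (2 <= n)%N -> d = (n * (n - 2))%N ->
  exists2 B : 'M[R]_(d, #|opair n|), row_free B &
    forall u, (u <= B)%MS <-> u *m incidence = 0 /\ mass u = 0.
Proof.
move=> n2 ->.
have rk : \rank (kermx tangent_eqs) = (n * (n - 2))%N.
  rewrite mxrank_ker rank_tangent_eqs // card_opair.
  by rewrite -[X in (_ - X)%N]muln1 -mulnBr; congr muln; lia.
rewrite -rk; exists (row_base (kermx tangent_eqs)); first exact: row_base_free.
move=> u; rewrite eq_row_base; split.
  by move=> /sub_kermxP/mul_tangent_eqs.
by move=> /mul_tangent_eqs uM; apply/sub_kermxP.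
Qed.

End Circulations.
Theorem proposition9 (R : realType) (n : nat) (n_ge3 : (3 <= n)%N) :
  (exists (N : nat) (P : set 'rV[R]_N),
      polytope P /\ has_dim P (n * (n - 2))%N /\
      order_isomorphic [set` Jc n]%classic (faces P)) /\
  homeomorphic
    (geometric_realization R (Jc n :\: [set finset.set0; [set: opair n]])%SET)
    (unit_sphere R (n ^ 2 - 2 * n - 1)%N).
Proof.
have n2 : (2 <= n)%N by apply: leq_trans n_ge3.
(* The point for [S] is a circulation with support [S] scaled to mass 1; 0 is a filler for the empty
   set and for sets outside [Jc n]. *)
have /choice[b bP] (S : {set opair n}) : exists x : 'rV[R]_#|opair n|,
    S \in Jc n -> S != finset.set0 -> slice incidence x /\ supp x = S.
  have [SJ|SJ] := boolP (S \in Jc n); last by exists 0.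
  have [->|S0] := eqVneq S finset.set0; first by exists 0.
  have [x cx xS] := Jc_supp (R := R) SJ.
  have x0 : x != 0 by apply: contraNneq S0 => x0; rewrite -xS x0 supp0.
  have [m0 sx] := slice_normalize cx x0.
  by exists ((mass x)^-1 *: x) => _ _; rewrite suppZ // invr_neq0 // gt_eqF.
have T0 : [set: opair n]%SET != finset.set0.
  by rewrite -card_gt0 cardsT card_opair muln_gt0; lia.
(* The interior point is the one chosen for the full arc set. *)
have [sc cT] := bP _ setT_Jc T0.
have LJ (x : 'rV[R]_#|opair n|) : cone incidence x -> supp x \in Jc n.
  exact: supp_Jc.
split.
  have [B fB BP] := @tangent_basis R n _ n2 erefl.
  exists #|opair n|, (slice incidence); split; [|split].
  - exact: (polytope_slice LJ bP).
  - exact: (has_dim_slice sc cT fB BP).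
  - exact: (slice_face_iso LJ bP).
(* For [n] at least 3 the subtractions do not truncate, and the successor of [n ^ 2 - 2 * n - 1] is
   [n * (n - 2)]. *)
have [|B fB BP] := @tangent_basis R n (n ^ 2 - 2 * n - 1).+1 n2.
  nia.
exact: (homeomorphic_realization_sphere LJ bP sc cT fB BP).
Qed.
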